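(* Let $b$ and $n$ be positive integers and let $C_b(n) := nb^n+1$. If $C_b(n)$ is prime, then $$n^{b^n}\equiv (-1)^b \pmod{C_b(n)}.$$
   Context: The integers $C_b(n) = nb^n+1$ are called Generalized Cullen Numbers. *)

(* Defs.v *)
From mathcomp Require Import all_boot all_order all_algebra.
Set Implicit Arguments.
Unset Strict Implicit.
Unset Printing Implicit Defensive.

Definition gen_cullen (b n : nat) : nat := n * b ^ n + 1.

(* Main.v *)
Require Import Defs.
From mathcomp Require Import all_boot all_order all_algebra.
From mathcomp Require Import all_solvable.
Set Implicit Arguments.
Unset Strict Implicit.
Unset Printing Implicit Defensive.
Import Order.TTheory GRing.Theory Num.Theory.
Local Open Scope ring_scope.

(** Put B = b ^ n and p = n * B + 1, so that n * B = -1 modulo p.  Raising this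
    to the power B gives n ^ B * B ^ B = (-1) ^ B.  The point is that
    B ^ B = b ^ (n * B) = b ^ (p - 1), which is 1 modulo p by Fermat's little
    theorem, while (-1) ^ B = (-1) ^ b because b ^ n and b have the same
    parity. *)

Lemma coprime_gen_cullen (b n : nat) : (0 < n)%N -> coprime b (gen_cullen b n).
Proof.
case: n => // n _.
by rewrite /gen_cullen /coprime expnS mulnCA mulnC gcdnMDl gcdn1.
Qed.

(** Since (b ^ n) ^ (b ^ n) = b ^ (n * b ^ n) and n * b ^ n is one less than
    the modulus, this is Fermat's little theorem. *)
Lemma gen_cullen_fermat (b n : nat) :
  (0 < n)%N -> prime (gen_cullen b n) ->
  (((b ^ n) ^ (b ^ n))%N = 1 %[mod gen_cullen b n])%N.
Proof.
move=> n_gt0 p_prime.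
have := Euler_exp_totient (coprime_gen_cullen b n_gt0).
by rewrite totient_prime // {1}/gen_cullen addn1 /= expnM.
Qed.

Theorem proposition4 (b n : nat) (hb : (0 < b)%N) (hn : (0 < n)%N)
  (hC : prime (gen_cullen b n)) :
  (n%:Z ^+ (b ^ n)%N = (-1) ^+ b %[mod (gen_cullen b n)%:Z])%Z.
Proof.
set B := (b ^ n)%N; set p := gen_cullen b n.
have BB1 : (B%:Z ^+ B = 1 %[mod p%:Z])%Z.
  by rewrite -!natz -natrX !natz !modz_nat gen_cullen_fermat.
have nB : (n%:Z * B%:Z = -1 %[mod p%:Z])%Z.
  apply/eqP; rewrite eqz_mod_dvd opprK.
  by rewrite -PoszM -PoszD dvdzz.
have signB : (-1) ^+ B = (-1) ^+ b :> int.
  by rewrite -[LHS]signr_odd oddX eqn0Ngt hn /= signr_odd.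
rewrite -signB -[RHS]modzXm -nB modzXm exprMn.
by rewrite -[RHS]modzMmr BB1 modzMmr mulr1.
Qed.
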